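(* Let $w\in \mathrm{F}_d$ be a word, and let $\mathcal{M}$ denote a family of sequences of probability measures (on finitely generated groups) that measure index uniformly. (1) If $w$ satisfies a gap for all finite groups, with gap function $\varepsilon(r)$, then $w$ satisfies a gap for all residually finite groups with respect to $\mathcal{M}$, with the same gap function $\varepsilon(r)$. (2) If $w$ satisfies a positivity result for all finite groups, then $w$ satisfies a positivity result for all residually finite groups with respect to $\mathcal{M}$.
   Context: A word is a nontrivial element $w$ of the free group $\mathrm{F}_d$ on $x_1,\dots,x_d$; it defines a map $w:G^d\to G$ for every group $G$, and $G$ satisfies $w$ if $w(g_1,\dots,g_d)=1$ for all $g_i\in G$. For a finite group $G$, $\Pr(w=1\text{ on }G)=|\{(g_1,\dots,g_d)\in G^d: w(g_1,\dots,g_d)=1\}|/|G|^d$. For a sequence $M=\{\mu_n\}$ of probability measures on $G$, $\Pr_M(w=1\text{ on }G)=\limsup_{n\to\infty}\mu_n^{\times d}(\{(g_1,\dots,g_d)\in G^d: w(g_1,\dots,g_d)=1\})$. $M=\{\mu_n\}$ measures index uniformly if $\mu_n(xH)\to 1/[G:H]$ (with $1/\infty=0$) as $n\to\infty$, uniformly over all $x\in G$ and all subgroups $H\le G$. A group is $r$-generated if it can be generated by $r$ elements. Gap for finite groups with gap function $\varepsilon:\mathbb{N}\to(0,1)$: for every $r$ and every $r$-generated finite group $G$, if $\Pr(w=1\text{ on }G)>1-\varepsilon(r)$ then $G$ satisfies $w$. Gap for residually finite groups with respect to $\mathcal{M}$ with gap function $\varepsilon$: for every $r$, every $r$-generated residually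 finite group $G$ and every sequence $M\in\mathcal{M}$ on $G$, if $\Pr_M(w=1\text{ on }G)>1-\varepsilon(r)$ then $G$ satisfies $w$. Positivity for finite groups: there is $\psi:(0,1)\times\mathbb{N}\to\mathbb{N}$ such that for every $\varepsilon\in(0,1)$ and every $r$-generated finite group $G$, if $\Pr(w=1\text{ on }G)\ge\varepsilon$ then $G$ has a subgroup of index $\le\psi(\varepsilon,r)$ satisfying $w$. Positivity for residually finite groups with respect to $\mathcal{M}$: there is such a function $\psi$ (possibly a different one) such that for every $\varepsilon\in(0,1)$, every $r$-generated residually finite group $G$ and every $M\in\mathcal{M}$ on $G$, if $\Pr_M(w=1\text{ on }G)\ge\varepsilon$ then $G$ has a subgroup of index $\le\psi(\varepsilon,r)$ satisfying $w$. *)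

(* Defs.v *)
From HB Require Import structures.
From mathcomp Require Import all_boot all_order all_algebra all_fingroup.
From mathcomp Require Import all_classical all_reals all_analysis.

Set Implicit Arguments.
Unset Strict Implicit.
Unset Printing Implicit Defensive.
Import Order.TTheory GRing.Theory Num.Theory.
Import numFieldNormedType.Exports.

Local Open Scope ring_scope.

(* The free group F_d is modelled by its reduced words: the letter (i, false)
   stands for x_i, the letter (i, true) for x_i^-1, and the unit is the empty
   word. *)
Definition letter (d : nat) := ('I_d * bool)%type.

Definition reduced d (s : seq (letter d)) : bool :=
  sorted (fun a b : letter d => ~~ ((a.1 == b.1) && (a.2 != b.2))) s.

Definition free_group (d : nat) := {s : seq (letter d) | reduced s}.

Definition free_one (d : nat) : free_group d := exist _ [::] isT.

Definition word_map d (w : free_group d) (G : groupType) (g : d.-tuple G) : G :=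
  (\prod_(a <- val w) (if a.2 then (tnth g a.1)^-1 else tnth g a.1))%g.

Definition satisfies d (w : free_group d) (G : groupType) (H : {pred G}) :=
  forall g : d.-tuple G, {subset g <= H} -> word_map w g = 1%g.

Section FiniteGroups.
Context (R : realType) (d : nat) (w : free_group d).

Definition fin_generated_by (r : nat) (gT : finGroupType) (G : {group gT}) :=
  exists s : r.-tuple gT, <<[set x in s]>>%g = G.

Definition Pr_fin (gT : finGroupType) (G : {group gT}) : R :=
  #|[set g : d.-tuple gT | all [in G] g & word_map w g == 1%g]|%:R
  / #|G|%:R ^+ d.

Definition gap_finite (eps : nat -> R) :=
  forall (r : nat) (gT : finGroupType) (G : {group gT}),
    fin_generated_by r G -> 1 - eps r < Pr_fin G -> satisfies w G.

Definition positivity_finite :=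
  exists psi : R -> nat -> nat,
    forall (eps : R) (r : nat) (gT : finGroupType) (G : {group gT}),
      0 < eps < 1 -> fin_generated_by r G -> eps <= Pr_fin G ->
      exists H : {group gT},
        [/\ H \subset G, (#|G : H|%g <= psi eps r)%N & satisfies w H].

End FiniteGroups.

Local Open Scope classical_set_scope.

Section Subgroups.
Context (G : groupType).

Definition generated_by (r : nat) :=
  exists s : r.-tuple G,
    forall H : groupClosed G, {subset s <= H} -> forall x, x \in H.

Definition finitely_generated := exists r, generated_by r.

Definition left_coset (x : G) (H : {pred G}) : set G :=
  [set (x * h)%g | h in [set` H]].

Definition left_cosets (H : {pred G}) : set (set G) :=
  range (left_coset ^~ H).

(* +oo for infinite index; the library's inverse satisfies +oo^-1 = 0. *)
Definition subgroup_index (R : realType) (H : {pred G}) : \bar R :=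
  counting (left_cosets H).

Definition normal_subgroup (N : {pred G}) :=
  forall x y, y \in N -> (y ^ x)%g \in N.

Definition residually_finite :=
  forall g : G, g != 1%g -> exists N : groupClosed G,
    [/\ normal_subgroup N, finite_set (left_cosets N) & g \notin N].

End Subgroups.

(* Probability measures on a group are defined on all of its subsets: the
   groups that occur are finitely generated, hence countable. *)
Definition discrete (G : groupType) : Type := G.

Section Discrete.
Context (G : groupType).
HB.instance Definition _ := Choice.on (discrete G).
HB.instance Definition _ := isPointed.Build (discrete G) (1%g : G).
HB.instance Definition _ := @isMeasurable.Build default_measure_display
  (discrete G) discrete_measurable discrete_measurable0
  discrete_measurableC discrete_measurableU.
End Discrete.

Section PowerProbability.
Context d (T : measurableType d) (R : realType) (mu : probability T R).

Definition tuple_cons n (p : T * n.-tuple T) : n.+1.-tuple T :=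
  [the n.+1.-tuple T of p.1 :: p.2].

Lemma measurable_tuple_cons n : measurable_fun setT (@tuple_cons n).
Proof. exact: measurable_cons. Qed.

HB.instance Definition _ n := isMeasurableFun.Build _ _ _ _ (@tuple_cons n)
  (@measurable_tuple_cons n).

Fixpoint power_probability (n : nat) : probability (n.-tuple T) R :=
  match n with
  | 0 => \d_[tuple]
  | n.+1 => distribution (mu \x power_probability n)%E (@tuple_cons n)
  end.

End PowerProbability.

Section ResiduallyFiniteGroups.
Context (R : realType).

Definition measures_index_uniformly (G : groupType)
    (mu : nat -> probability (discrete G) R) :=
  forall e : R, 0 < e -> \forall n \near \oo,
    forall (x : G) (H : groupClosed G),
      (`|mu n (left_coset x H) - (subgroup_index R H)^-1| < e%:E)%E.

Definition Pr_seq d (w : free_group d) (G : groupType)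
    (mu : nat -> probability (discrete G) R) : \bar R :=
  limn_esup (fun n => power_probability (mu n) d
    [set g : d.-tuple G | word_map w g = 1%g]).

Definition measure_family :=
  forall G : groupType, set (nat -> probability (discrete G) R).

Definition gap_residually_finite d (w : free_group d) (M : measure_family)
    (eps : nat -> R) :=
  forall (r : nat) (G : groupType) (mu : nat -> probability (discrete G) R),
    generated_by G r -> residually_finite G -> M G mu ->
    ((1 - eps r)%:E < Pr_seq w mu)%E -> satisfies w (@predT G).

Definition positivity_residually_finite d (w : free_group d)
    (M : measure_family) :=
  exists psi : R -> nat -> nat,
    forall (eps : R) (r : nat) (G : groupType)
        (mu : nat -> probability (discrete G) R),
      0 < eps < 1 -> generated_by G r -> residually_finite G -> M G mu ->
      (eps%:E <= Pr_seq w mu)%E ->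
      exists H : groupClosed G,
        (subgroup_index R H <= (psi eps r)%:R%:E)%E /\ satisfies w H.

End ResiduallyFiniteGroups.

(* Main.v *)
Require Import Defs.
From HB Require Import structures.
From mathcomp Require Import all_boot all_order all_algebra all_fingroup.
From mathcomp Require Import finmap.
From mathcomp Require Import all_classical all_reals all_analysis.
Import Order.TTheory GRing.Theory Num.Theory.
Import numFieldNormedType.Exports.
Import Algebra.
Set Implicit Arguments.
Unset Strict Implicit.
Unset Printing Implicit Defensive.
Local Open Scope classical_set_scope.
Local Open Scope ring_scope.

(** Both parts rest on one comparison. If [N] is a normal subgroup of finite
index in [G], then [w(g) = 1] forces [w] to vanish on the image of [g] in
[G / N], and the event that [w] vanishes on the image is a finite union of
boxes of cosets of [N]. Measuring index uniformly says that in the limit every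
coset of [N] has mass [1 / #|G / N|], so the measures of this event converge to
the probability that [w = 1] on [G / N]. Hence the limsup probability on [G] is
at most the probability on every finite quotient ([Pr_seq_le_Pr_fin]). The
quotient is again generated by [r] elements ([image_generated]).

Gap: if the limsup exceeds [1 - eps r], then so does the probability on every
finite quotient, so every finite quotient satisfies [w]; all values of [w] lie
in every [N], and residual finiteness makes them trivial.

Positivity: every finite quotient has a subgroup of index at most
[k = psi eps r] that satisfies [w]. Its preimage in [G] is a subgroup [H] of
index at most [k] on which [w] takes values in [N], but [H] depends on [N].
The dependence is removed by compactness ([satisfies_compactness]): the sets of
such [H], as [N] varies, generate a proper filter on the subgroups of [G]. An
ultrafilter refining it has a limit, the subgroup of the elements that belong
to almost all [H]. A property that is tested on finitely many memberships at a
time passes to the limit; this covers both having index at most [k], in its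
pigeonhole form [index_le], and having values of [w] in a given [N]. So the
limit subgroup has index at most [k] and satisfies [w], and the same function
[psi] works. *)

Section Groups.
Local Open Scope group_scope.

(** * Subgroups, cosets and finite quotients *)

Lemma subgroup_comprehension (G : groupType) (P : G -> Prop) :
  P 1 -> (forall x y, P x -> P y -> P (x * y)) -> (forall x, P x -> P x^-1) ->
  exists H : groupClosed G, forall x, (x \in H) = `[<P x>].
Proof.
move=> P1 PM PV; pose S : {pred G} := fun x => `[<P x>].
have SM : mulg_closed S.
  by move=> x y /asboolP Px /asboolP Py; apply/asboolP/PM.
have S1 : 1 \in S by apply/asboolP.
have SV : invg_closed S by move=> x /asboolP Px; apply/asboolP/PV.
pose m1 := isMulClosed.Build G S SM.
pose m2 := isMul1Closed.Build G S S1.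
pose m3 := isInvClosed.Build G S SV.
pose H : groupClosed G := HB.pack S m1 m2 m3.
by exists H.
Qed.

Lemma left_cosetP (G : groupType) (H : groupClosed G) (x y : G) :
  left_coset x H y <-> x^-1 * y \in H.
Proof.
split=> [[h hH <-]|xyH]; first by rewrite mulKg.
by exists (x^-1 * y) => //; rewrite mulKVg.
Qed.

Lemma eq_left_coset (G : groupType) (H : groupClosed G) (x y : G) :
  left_coset x H = left_coset y H <-> x^-1 * y \in H.
Proof.
split=> [exy|xyH].
  by apply/left_cosetP; rewrite exy; apply/left_cosetP; rewrite mulVg gpred1.
apply/seteqP; split=> z /left_cosetP zH; apply/left_cosetP.
  by rewrite -(mulKVg x z) mulgA gpredMl// -gpredV invgM invgK.
by rewrite -(mulKVg y z) mulgA gpredMl.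
Qed.

(** The quotient group is realised inside a symmetric group: since [N] is
normal, right multiplication permutes the finitely many left cosets of [N], and
the elements that act trivially are those of [N]. Right multiplication is used
because permutations are composed from left to right. *)
Lemma finite_quotient (G : groupType) (N : groupClosed G) :
  normal_subgroup N -> finite_set (left_cosets N) ->
  exists (gT : finGroupType) (phi : UMagmaMorphism.type G gT),
    forall x, (phi x == 1) = (x \in N).
Proof.
move=> normalN /finite_fsetP[F FE].
have inF x : left_coset x N \in F.
  suff: [set` F] (left_coset x N) by [].
  by rewrite -FE; exists x.
pose coset x : F := finmap.FSetSub (inF x).
have cosetE x y : coset x = coset y <-> x^-1 * y \in N.
  rewrite -eq_left_coset; split=> [/(congr1 val)//|e]; exact: val_inj.
have /choice[sec secK] (f : F) : exists x, coset x = f.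
  have : left_cosets N (val f) by rewrite FE; exact: valP.
  by move=> [x _ xf]; exists x; apply: val_inj.
have normalE x y : (y ^ x \in N) = (y \in N).
  apply/idP/idP => [/(@normalN x^-1)|]; last exact: normalN.
  by rewrite conjgK.
have act_inj x : injective (fun f => coset (sec f * x)).
  move=> f g /cosetE; rewrite invgM -!mulgA (mulgA (sec f)^-1).
  rewrite -[_^-1 * _]/(_ ^ x) normalE -{2}[f]secK -{2}[g]secK.
  by move=> /cosetE.
pose phi x : {perm F} := perm (act_inj x).
have phiM : {morph phi : x y / x * y}.
  move=> x y; apply/permP => f; rewrite permM !permE; apply/cosetE.
  have /cosetE e := secK (coset (sec f * x)).
  rewrite [in X in X^-1]mulgA invgM -!mulgA (mulgA (sec f * x)^-1).
  by rewrite -[y^-1 * _]/(_ ^ y) normalE -gpredV invgM invgK.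
have phi1 : phi 1 = 1.
  by apply/permP => f; rewrite permE perm1 mulg1 secK.
pose m1 := isMultiplicative.Build G {perm F} phi phiM.
pose m2 := Multiplicative_isUMagmaMorphism.Build G {perm F} phi phi1.
pose phi' : UMagmaMorphism.type G {perm F} := HB.pack phi m1 m2.
exists _, phi' => x; apply/eqP/idP => [/permP/(_ (coset 1))|xN].
  rewrite permE perm1 => /cosetE; have /cosetE e := secK (coset 1).
  (* [sec (coset 1)] need not be 1, but it lies in [N]. *)
  by move: e; rewrite !mulg1 !gpredV => e; rewrite gpredMl.
apply/permP => f; rewrite permE perm1 -[RHS]secK; apply/cosetE.
by rewrite invgM -mulgA mulVg mulg1 gpredV.
Qed.

(** * Word maps *)

Section WordMap.
Context (d : nat) (w : free_group d).

Lemma word_map_morph (G H : groupType) (phi : UMagmaMorphism.type G H)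
    (g : d.-tuple G) :
  phi (word_map w g) = word_map w (map_tuple phi g).
Proof.
rewrite /word_map gmulf_prod; apply: eq_bigr => a _.
by case: ifP => _; rewrite ?gmulfV tnth_map.
Qed.

End WordMap.

(** * The image of a morphism to a finite group *)

Lemma morph_image_group (G : groupType) (gT : finGroupType)
    (phi : UMagmaMorphism.type G gT) :
  exists P : {group gT}, forall a, a \in P <-> exists x, phi x = a.
Proof.
pose A := [set a : gT | `[<exists x, phi x = a>]]%SET.
have AE a : a \in A <-> exists x, phi x = a.
  by rewrite inE; split=> [/asboolP|?]; last exact/asboolP.
have gA : group_set A.
  apply/group_setP; split; first by apply/AE; exists 1; rewrite gmulf1.
  move=> _ _ /AE[x <-] /AE[y <-]; apply/AE; exists (x * y); exact: gmulfM.
by exists (Group gA).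
Qed.

Section FiniteImage.
Context (G : groupType) (gT : finGroupType) (phi : UMagmaMorphism.type G gT).
Context (P : {group gT}) (PE : forall a, a \in P <-> exists x, phi x = a).

Lemma morph_in_image x : phi x \in P.
Proof. by apply/PE; exists x. Qed.

(** Read in [G], the subgroup generated by the images of the generators is the
preimage of a subgroup; it contains the generators, so it is all of [G]. *)
Lemma image_generated r : generated_by G r -> fin_generated_by r P.
Proof.
move=> [s genG]; exists (map_tuple phi s); apply/eqP.
rewrite finset.eqEsubset; apply/andP; split.
  rewrite gen_subG; apply/fintype.subsetP => a; rewrite inE => /mapP[x _ ->].
  exact: morph_in_image.
pose D := <<[set x in map_tuple phi s]>>%G.
have [|x y|x|H HE] := @subgroup_comprehension G (fun x => phi x \in D).
- by rewrite gmulf1 group1.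
- by rewrite gmulfM; exact: groupM.
- by rewrite gmulfV groupV.
apply/fintype.subsetP => _ /PE[x <-].
suff: x \in H by rewrite HE => /asboolP.
apply: genG => y ys; rewrite HE; apply/asboolP/mem_gen.
by rewrite inE map_f.
Qed.

Lemma left_coset_kernel (N : groupClosed G) :
  (forall x, (phi x == 1) = (x \in N)) ->
  forall x, left_coset x N = phi @^-1` [set phi x].
Proof.
move=> kerN x; apply/seteqP; split=> y /=.
  move/left_cosetP; rewrite -kerN gmulfM gmulfV.
  by move=> /eqP/(canRL (mulKVg _)); rewrite mulg1.
by move=> e; apply/left_cosetP; rewrite -kerN gmulfM gmulfV e mulVg.
Qed.

Lemma subgroup_index_kernel (R : realType) (N : groupClosed G) :
  (forall x, (phi x == 1) = (x \in N)) ->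
  subgroup_index R N = (#|P|%:R)%:E.
Proof.
move=> kerN; pose fib a : set G := phi @^-1` [set a].
have E : left_cosets N = fib @` [set` P].
  apply/seteqP; split=> [_ [x _ <-]|_ [_ /PE[x <-] <-]].
    exists (phi x); rewrite ?(left_coset_kernel kerN)//.
    exact: morph_in_image.
  by exists x => //; rewrite (left_coset_kernel kerN).
have fib_inj : {in [set` P] &, injective fib}.
  move=> a b /set_mem /PE[x xa] _ ab.
  have : fib b x by rewrite -ab.
  by rewrite /fib /= xa.
have PI : ([set` P] #= `I_#|P|)%card.
  have -> : [set` P] = @enum_val gT (mem P) @` setT.
    apply/seteqP; split=> [a aP|_ [i _ <-]]; last exact: enum_valP.
    by exists (enum_rank_in aP a) => //; rewrite enum_rankK_in.
  rewrite card_eq_sym; apply: card_eq_trans card_II _.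
  by rewrite card_eq_sym; apply: inj_card_eq => i j _ _; exact: enum_val_inj.
have LI : (left_cosets N #= `I_#|P|)%card.
  by rewrite E; exact: card_eq_trans (inj_card_eq fib_inj) PI.
rewrite /subgroup_index /counting asboolT; last by exists #|P|.
by rewrite (card_fset_set LI).
Qed.
End FiniteImage.

End Groups.

(** * The power of a probability measure *)

Lemma measurable_box d (T : measurableType d) n (B : 'I_n -> set T) :
  (forall i, measurable (B i)) ->
  measurable [set g : n.-tuple T | forall i, B i (tnth g i)].
Proof.
move=> mB.
have -> : [set g : n.-tuple T | forall i, B i (tnth g i)] =
    \bigcap_(i in [set: 'I_n]) ((tnth (T:=T))^~ i @^-1` B i).
  by apply/seteqP; split=> g /= gB i; [move=> _|]; exact: gB.
apply: fin_bigcap_measurable => // i _.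
rewrite -[X in measurable X]setTI.
exact: measurable_tnth.
Qed.

Lemma power_probability_box d (T : measurableType d) (R : realType)
    (mu : probability T R) n (B : 'I_n -> set T) :
  (forall i, measurable (B i)) ->
  power_probability mu n [set g : n.-tuple T | forall i, B i (tnth g i)] =
  (\prod_(i < n) fine (mu (B i)))%:E.
Proof.
elim: n B => [|n IH] B mB /=.
  by rewrite big_ord0 diracE mem_set//= => -[].
rewrite /distribution /pushforward /=.
have -> : @tuple_cons d T n @^-1` [set g | forall i, B i (tnth g i)] =
    B ord0 `*` [set g : n.-tuple T | forall i, B (lift ord0 i) (tnth g i)].
  apply/seteqP; split=> -[x g] /=.
    move=> gB; split=> [|i]; first by have := gB ord0; rewrite tnth0.
    by have := gB (lift ord0 i); rewrite tnthS.
  move=> [Bx gB] i; case: (unliftP ord0 i) => [j ->|->]; last by rewrite tnth0.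
  by rewrite tnthS.
rewrite product_measure1E//; last first.
  exact: (@measurable_box _ T n (fun i => B (lift ord0 i))).
rewrite big_ord_recl EFinM fineK//; last exact: fin_num_measure.
congr (_ * _)%E; exact: IH.
Qed.

(** An event that depends only on the values of [f] at the coordinates splits
into the disjoint boxes whose sides are fibres of [f]. *)
Lemma power_probability_fibres d (T : measurableType d) (R : realType)
    (mu : probability T R) n (I : finType) (f : T -> I)
    (mf : forall a, measurable (f @^-1` [set a])) (S : {set n.-tuple I}) :
  let A := [set g : n.-tuple T | map_tuple f g \in S] in
  measurable A /\
  power_probability mu n A =
  (\sum_(t in S) \prod_(i < n) fine (mu (f @^-1` [set tnth t i])))%:E.
Proof.
pose box (t : n.-tuple I) : set (n.-tuple T) :=
  [set g | forall i, (f @^-1` [set tnth t i]) (tnth g i)].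
have boxE t g : box t g <-> map_tuple f g = t.
  split=> [gt|<- i /=]; last by rewrite tnth_map.
  by apply: eq_from_tnth => i; rewrite tnth_map gt.
have mbox t : measurable (box t) by exact:
  (@measurable_box _ T n (fun i => f @^-1` [set tnth t i]) (fun i => mf _)).
have -> : [set g : n.-tuple T | map_tuple f g \in S] =
    \bigcup_(t in [set` S]) box t.
  apply/seteqP; split=> [g gS|g [t tS /boxE gt] /=]; last by rewrite gt.
  by exists (map_tuple f g) => //; exact/boxE.
split; first exact: fin_bigcup_measurable.
rewrite measure_fin_bigcup//; last first.
  by move=> t u _ _ [g [/boxE <- /boxE <-]].
rewrite -(@bigfs _ _ _ _ (index_enum _) (mem S)) ?index_enum_uniq//; last first.
  by move=> t _; rewrite mem_index_enum.
by rewrite -sumEFin; apply: eq_bigr => t _; exact: power_probability_box.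
Qed.

Lemma generated_countable (G : groupType) r :
  generated_by G r -> countable [set: G].
Proof.
move=> [s genG].
pose ev (u : seq ('I_r * bool)) : G :=
  (\prod_(a <- u) (if a.2 then (tnth s a.1)^-1 else tnth s a.1))%g.
have evM u v : (ev u * ev v)%g = ev (u ++ v) by rewrite /ev big_cat.
have evV u : exists v, ((ev u)^-1)%g = ev v.
  elim: u => [|a u [v uv]]; first by exists [::]; rewrite /ev big_nil invg1.
  exists (v ++ [:: (a.1, ~~ a.2)]); rewrite -evM -uv /ev big_cons invgM.
  by rewrite big_seq1 /=; case: a.2; rewrite //= invgK.
have [|x y|x|H HE] := @subgroup_comprehension G (fun x => exists u, ev u = x).
- by exists [::]; rewrite /ev big_nil.
- by move=> [u <-] [v <-]; exists (u ++ v); rewrite evM.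
- by move=> [u <-]; have [v ->] := evV u; exists v.
have -> : [set: G] = range ev.
  apply/seteqP; split=> x _ //.
  have /asboolP[u <-] : `[<exists u, ev u = x>]; last by exists u.
  rewrite -HE; apply: genG => _ /tnthP[i ->]; rewrite HE; apply/asboolP.
  by exists [:: (i, false)]; rewrite /ev big_seq1.
by apply: card_le_trans (card_image_le ev setT) _; exact: countableP.
Qed.

(** Points of the product are measurable, so countability makes all sets of
tuples measurable. In particular the event [w = 1] is; it is defined through
the multiplication of [G], which the product sigma-algebra does not see. *)
Lemma countable_tuple_measurable (G : groupType) n :
  countable [set: G] -> forall A : set (n.-tuple (discrete G)), measurable A.
Proof.
move=> cG A; apply: countable_measurable.
  move=> t; have -> : [set t] = [set g : n.-tuple (discrete G) |
      forall i, [set tnth t i] (tnth g i)].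
    by apply/seteqP; split=> [g ->//|g gt]; exact: eq_from_tnth.
  exact: (@measurable_box _ (discrete G) n (fun i => [set tnth t i])).
have /countable_injP[f f_inj] := cG.
have : injective (map_tuple f : n.-tuple G -> n.-tuple nat).
  move=> g h /(congr1 val) /inj_map e; apply/val_inj/e => x y.
  by apply: f_inj; rewrite inE.
move=> m_inj.
apply/countable_injP; exists (choice.pickle \o map_tuple f) => g h _ _ /= gh.
by apply: m_inj; exact: (pcan_inj choice.pickleK).
Qed.

Lemma le_limn_esup (R : realType) (u v : (\bar R)^nat) :
  (forall n, u n <= v n)%E -> (limn_esup u <= limn_esup v)%E.
Proof.
move=> uv; rewrite !limn_esup_lim; apply: lee_lim; [exact: is_cvg_esups..|].
apply: nearW => n; apply: ge_ereal_sup => _ [k kn <-].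
by apply: (le_trans (uv k)); apply: ereal_sup_ubound; exists k.
Qed.

(** * Comparison with the finite quotients *)

Section Pr.
Context (R : realType) (d : nat) (w : free_group d).

Lemma Pr_finE (gT : finGroupType) (P : {group gT}) :
  \sum_(t in [set t : d.-tuple gT | all [in P] t & word_map w t == 1%g]%SET)
    \prod_(i < d) (#|P|%:R^-1 : R) = Pr_fin R w P.
Proof.
rewrite /Pr_fin prodr_const card_ord sumr_const exprVn.
by rewrite [RHS]mulr_natl.
Qed.

(** The kernel [N] of [phi] has index [#|P|] and its cosets are the fibres of
[phi], so the mass of each fibre over [P] tends to [1 / #|P|]. The event
[w = 1] is contained in the event that [w] vanishes on the images, whose
measure is a fixed polynomial in the masses of the fibres. *)
Lemma Pr_seq_le_Pr_fin (G : groupType) (mu : nat -> probability (discrete G) R)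
    r (gT : finGroupType) (phi : UMagmaMorphism.type G gT) (P : {group gT})
    (N : groupClosed G) :
  generated_by G r -> measures_index_uniformly mu ->
  (forall a, a \in P <-> exists x, phi x = a) ->
  (forall x, (phi x == 1%g) = (x \in N)) ->
  (Pr_seq w mu <= (Pr_fin R w P)%:E)%E.
Proof.
move=> genG mu_unif PE kerN.
pose S := [set t : d.-tuple gT | all [in P] t & word_map w t == 1%g]%SET.
pose fib (a : gT) : set (discrete G) := phi @^-1` [set a].
pose v n := \sum_(t in S) \prod_(i < d) fine (mu n (fib (tnth t i))).
have v_cvg : (v n)%:E @[n --> \oo] --> (Pr_fin R w P)%:E.
  apply: cvg_EFin; first by apply: nearW.
  rewrite -Pr_finE.
  apply: cvg_big => [|t tS]; first exact: add_continuous.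
  apply: cvg_big => [|i _]; first exact: mul_continuous.
  have [x xi] : exists x, phi x = tnth t i.
    by apply/PE; move: tS; rewrite inE => /andP[/all_tnthP/(_ i)].
  apply/cvgrPdist_lt => e e0; have := mu_unif e e0; apply: filterS => n.
  move=> /(_ x N); rewrite (left_coset_kernel kerN) xi -/(fib _).
  rewrite (subgroup_index_kernel PE R kerN) inver pnatr_eq0.
  rewrite gtn_eqF ?cardG_gt0//.
  rewrite -[mu n _]fineK ?fin_num_measure//.
  by rewrite -EFinB abse_EFin lte_fin distrC.
have [_ <-] := cvg_limn_einf_sup v_cvg.
apply: le_limn_esup => n.
have [mA <-] := power_probability_fibres (mu n) (f := phi) (fun _ => I) S.
apply: le_measure; rewrite ?inE//.
  exact: (countable_tuple_measurable (generated_countable genG)).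
move=> g /= wg1; rewrite inE -word_map_morph wg1 gmulf1 eqxx andbT.
by apply/allP => _ /mapP[x _ ->]; apply/PE; exists x.
Qed.
End Pr.

(** * Ultralimits of subgroups *)

(** Index at most [k] in the form of the pigeonhole principle. This form only
mentions finitely many memberships in [H] at a time, which is what lets it pass
to ultralimits. *)
Definition index_le k (G : groupType) (H : {pred G}) :=
  forall x : 'I_k.+1 -> G, exists i j, i != j /\ ((x i)^-1 * x j)%g \in H.

Lemma subgroup_index_le (R : realType) k (G : groupType) (H : groupClosed G) :
  index_le k H -> (subgroup_index R H <= k%:R%:E)%E.
Proof.
move=> Hk.
have small (B : {fset set G}) : [set` B] `<=` left_cosets H -> (#|` B| <= k)%N.
  move=> sB; rewrite leqNgt; apply/negP => kB.
  have Bi (i : 'I_k.+1) : nth set0 B i \in B.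
    by apply: mem_nth; exact: leq_trans (ltn_ord i) kB.
  have /choice[x xE] (i : 'I_k.+1) : exists x, left_coset x H = nth set0 B i.
    by have [x _ xi] := sB _ (Bi i); exists x.
  have [i [j [nij /eq_left_coset]]] := Hk x; rewrite !xE => /eqP.
  rewrite nth_uniq ?fset_uniq ?(leq_trans (ltn_ord _) kB)// => /eqP ij.
  by move: nij; rewrite -(inj_eq val_inj) /= ij eqxx.
have fH : finite_set (left_cosets H).
  apply: contrapT => /(@infinite_set_fset _ _ k.+1)[B /small + kB].
  by rewrite leqNgt kB.
rewrite /subgroup_index /counting asboolT// lee_fin ler_nat.
by apply: small; rewrite fset_setK.
Qed.

Lemma index_le_preimage (G : groupType) (gT : finGroupType)
    (phi : UMagmaMorphism.type G gT) (P K : {group gT}) k :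
  (forall x, phi x \in P) -> (#|P : K|%g <= k)%N ->
  index_le k [pred x | phi x \in K].
Proof.
move=> phiP PKk x.
have : ~~ injectiveb (fun i : 'I_k.+1 => (phi (x i) *: K)%g).
  apply/negP => /injectiveP c_inj.
  have : (k.+1 <= k)%N; last by rewrite ltnn.
  apply: leq_trans PKk; rewrite -card_lcosets -[X in (X <= _)%N]card_ord.
  rewrite -(card_imset _ c_inj); apply/subset_leq_card/fintype.subsetP.
  by move=> _ /imsetP[i _ ->]; apply/lcosetsP; exists (phi (x i)).
move=> /injectivePn[i [j nij e]]; exists i, j; split=> //.
by rewrite inE gmulfM gmulfV -mem_lcoset e lcoset_refl.
Qed.

Lemma ultralimit_subgroup (G : groupType) (F : set_system (groupClosed G)) :
  Filter F ->
  exists L : groupClosed G, forall x, (x \in L) = `[<F [set H | x \in H]>].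
Proof.
move=> FF; apply: subgroup_comprehension => [|x y Fx Fy|x Fx].
- by apply: filterE => H /=; exact: gpred1.
- by apply: filterS2 Fx Fy => H /=; exact: gpredM.
- by apply: filterS Fx => H /=; rewrite gpredV.
Qed.

(** If [k.+1] elements were in different cosets of the limit [L], then for each
of the finitely many pairs almost no [H] would identify the two elements; some
[H] of index at most [k] would thus separate all of them. *)
Lemma ultralimit_index_le (G : groupType) (F : set_system (groupClosed G)) k
    (L : groupClosed G) :
  UltraFilter F -> (forall x, (x \in L) = `[<F [set H | x \in H]>]) ->
  F [set H | index_le k H] -> index_le k L.
Proof.
move=> UF LE Fk x; apply: contrapT => nL.
have FN i j : i != j -> F [set H : groupClosed G | ((x i)^-1 * x j)%g \notin H].
  move=> nij; have [Fij|] := in_ultra_setVsetC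
      [set H : groupClosed G | ((x i)^-1 * x j)%g \in H] UF.
    by exfalso; apply: nL; exists i, j; split=> //; rewrite LE; apply/asboolP.
  by apply: filterS => H /= /negP.
have FA : F [set H : groupClosed G |
    forall i j, i != j -> ((x i)^-1 * x j)%g \notin H].
  apply: filter_forall => i; apply: filter_forall => j.
  case: (eqVneq i j) => [_|nij]; first exact: filterE.
  by apply: filterS (FN i j nij) => H.
have [H [Hk HA]] := filter_ex (filterI Fk FA).
have [i [j [nij]]] := Hk x.
by apply/negP; exact: HA.
Qed.

(** A tuple of elements of [L] lies in almost every [H], so its value under [w]
lies in every [N]. *)
Lemma ultralimit_satisfies d (w : free_group d) (G : groupType)
    (F : set_system (groupClosed G)) (L : groupClosed G) :
  residually_finite G ->
  UltraFilter F -> (forall x, (x \in L) = `[<F [set H | x \in H]>]) ->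
  (forall N : groupClosed G, normal_subgroup N -> finite_set (left_cosets N) ->
    F [set H | forall g : d.-tuple G, {subset g <= H} -> word_map w g \in N]) ->
  satisfies w L.
Proof.
move=> rfG UF LE FN g gL; apply/eqP; apply: contrapT.
move=> /negP /rfG[N [nN fN /negP]]; apply.
have Fg : F [set H : groupClosed G | forall i, tnth g i \in H].
  apply: filter_forall => i.
  by have := gL _ (mem_tnth i g); rewrite LE => /asboolP.
have [H [HN Hg]] := filter_ex (filterI (FN N nN fN) Fg).
by apply: HN => _ /tnthP[i ->]; exact: Hg.
Qed.

Lemma normal_finite_index_setI (G : groupType) (N1 N2 : groupClosed G) :
  normal_subgroup N1 -> finite_set (left_cosets N1) ->
  normal_subgroup N2 -> finite_set (left_cosets N2) ->
  exists N : groupClosed G, [/\ normal_subgroup N, finite_set (left_cosets N) &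
    forall x, (x \in N) = (x \in N1) && (x \in N2)].
Proof.
move=> n1 f1 n2 f2.
have [|x y|x|N NE] := @subgroup_comprehension G
    (fun x => (x \in N1) && (x \in N2)).
- by rewrite !gpred1.
- by move=> /andP[x1 x2] /andP[y1 y2]; rewrite !gpredM.
- by rewrite !gpredV.
have {}NE x : (x \in N) = (x \in N1) && (x \in N2) by rewrite NE asboolb.
exists N; split=> //.
  by move=> x y; rewrite !NE => /andP[/(n1 x)-> /(n2 x)->].
apply: sub_finite_set (finite_image11 (fun A B => A `&` B) f1 f2).
move=> _ [x _ <-]; exists x => //.
apply/seteqP; split=> y.
  by move=> [/left_cosetP y1 /left_cosetP y2]; apply/left_cosetP; rewrite NE y1.
by move=> /left_cosetP; rewrite NE => /andP[y1 y2]; split; apply/left_cosetP.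
Qed.

(** The finite-index normal subgroups are directed under intersection, so the
sets [B N] of admissible subgroups form a filter base; they are nonempty by
hypothesis. *)
Lemma satisfies_compactness d (w : free_group d) (G : groupType) k :
  residually_finite G ->
  (forall N : groupClosed G, normal_subgroup N -> finite_set (left_cosets N) ->
    exists H : groupClosed G, index_le k H /\
      forall g : d.-tuple G, {subset g <= H} -> word_map w g \in N) ->
  exists H : groupClosed G, index_le k H /\ satisfies w H.
Proof.
move=> rfG locG.
pose D := [set N : groupClosed G |
  normal_subgroup N /\ finite_set (left_cosets N)].
pose B (N : groupClosed G) := [set H : groupClosed G | index_le k H /\
  forall g : d.-tuple G, {subset g <= H} -> word_map w g \in N].
have [N0 DN0] : exists N, D N.
  have [|//|//|N NE] := @subgroup_comprehension G (fun=> True); first by [].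
  exists N; split=> [x y _|]; first by rewrite NE; apply/asboolP.
  apply: (@sub_finite_set _ _ [set setT]) => //.
  move=> _ [x _ <-]; apply/seteqP; split=> // y _; apply/left_cosetP.
  by rewrite NE; apply/asboolP.
have FB : ProperFilter (filter_from D B).
  apply: filter_from_proper => [|N [nN fN]]; last exact: locG.
  apply: filter_from_filter; first by exists N0.
  move=> N1 N2 [n1 f1] [n2 f2].
  have [N [nN fN NE]] := normal_finite_index_setI n1 f1 n2 f2.
  exists N => // H [Hk HN].
  by split; split=> // g /HN; rewrite NE => /andP[].
have [F [UF sF]] := ultraFilterLemma FB.
have [L LE] := ultralimit_subgroup (F := F) _.
exists L; split.
  apply: (ultralimit_index_le UF LE).
  by apply: (filterS (P := B N0)) => [H []//|]; apply: sF; exists N0.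
apply: (ultralimit_satisfies rfG UF LE) => N nN fN.
by apply: (filterS (P := B N)) => [H []//|]; apply: sF; exists N.
Qed.

(** * Transfer from finite to residually finite groups *)

Theorem theorem3p4 (R : realType) (d : nat) (w : free_group d)
    (w_nontrivial : w <> free_one d) (M : measure_family R)
    (M_uniform : forall (G : groupType)
        (mu : nat -> probability (discrete G) R),
      M G mu -> finitely_generated G /\ measures_index_uniformly mu) :
  (forall eps : nat -> R, (forall r : nat, 0 < eps r < 1) ->
     gap_finite w eps -> gap_residually_finite w M eps) /\
  (positivity_finite R w -> positivity_residually_finite w M).
Proof.
split=> [eps _ gapw|[psi psiP]].
  move=> r G mu genG rfG /M_uniform[_ mu_unif] Pr_gt g _.
  apply/eqP; apply: contrapT => /negP /rfG[N [nN fN /negP]]; apply.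
  have [gT [phi kerN]] := finite_quotient nN fN.
  have [P PE] := morph_image_group phi.
  have wP : satisfies w P.
    apply: gapw (image_generated PE genG) _; rewrite -lte_fin.
    exact: lt_le_trans Pr_gt (Pr_seq_le_Pr_fin w genG mu_unif PE kerN).
  rewrite -kerN word_map_morph wP// => _ /mapP[x _ ->]; exact: morph_in_image.
exists psi => eps r G mu eps01 genG rfG /M_uniform[_ mu_unif] Pr_ge.
suff [H [Hk wH]] : exists H : groupClosed G,
    index_le (psi eps r) H /\ satisfies w H.
  by exists H; split=> //; exact: subgroup_index_le.
apply: satisfies_compactness => // N nN fN.
have [gT [phi kerN]] := finite_quotient nN fN.
have [P PE] := morph_image_group phi.
have [|K [KP PKk wK]] := psiP eps r gT P eps01 (image_generated PE genG).
  rewrite -lee_fin.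
  exact: le_trans Pr_ge (Pr_seq_le_Pr_fin w genG mu_unif PE kerN).
have [|x y|x|H HE] := @subgroup_comprehension G (fun x => phi x \in K).
- by rewrite gmulf1 group1.
- by rewrite gmulfM; exact: groupM.
- by rewrite gmulfV groupV.
have {}HE x : (x \in H) = (phi x \in K) by rewrite HE asboolb.
exists H; split=> [x|g gH].
  have [i [j]] := index_le_preimage (morph_in_image PE) PKk x.
  by rewrite inE -HE; exists i, j.
by rewrite -kerN word_map_morph wK// => _ /mapP[x /gH + ->]; rewrite HE.
Qed.
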